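(* Let $\nu:\mathcal O(X)\to\mathcal B(\mathcal H_1)$ and $\omega:\mathcal O(X)\to\mathcal B(\mathcal H_2)$ be POVMs. Then there exist unique POVMs $\omega_a,\omega_s:\mathcal O(X)\to\mathcal B(\mathcal H_2)$ such that $\omega=\omega_a+\omega_s$, $\omega_a\ll_{\rm ac}\nu$ and $\omega_s\perp\nu$.
   Context: $X$ is a locally compact Hausdorff space with Borel $\sigma$-algebra $\mathcal O(X)$; $\mathcal H_1,\mathcal H_2$ are separable Hilbert spaces. A POVM $\nu:\mathcal O(X)\to\mathcal B(\mathcal H)$ is a map with positive operator values that is countably additive on pairwise disjoint countable families, with convergence in the ultraweak topology. For POVMs on $\mathcal O(X)$ (possibly on different Hilbert spaces): $\vartheta_2\ll_{\rm ac}\vartheta_1$ means $\vartheta_2(E)=0$ whenever $E\in\mathcal O(X)$ and $\vartheta_1(E)=0$; $\vartheta_1\perp\vartheta_2$ means there are disjoint $A,B\in\mathcal O(X)$ with $A\cup B=X$ such that $\vartheta_1$ is zero on all measurable subsets of $B$ and $\vartheta_2$ is zero on all measurable subsets of $A$. *)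

(* Defs.v *)
From HB Require Import structures.
From mathcomp Require Import all_boot all_order all_algebra sesquilinear.
From mathcomp Require Import complex.
From mathcomp Require Import all_classical all_reals all_analysis.

Set Implicit Arguments.
Unset Strict Implicit.
Unset Printing Implicit Defensive.

Import Order.TTheory GRing.Theory Num.Theory Num.Def.
Import numFieldNormedType.Exports.

Local Open Scope classical_set_scope.
Local Open Scope complex_scope.
Local Open Scope ring_scope.

(* Complex Hilbert spaces. The inner product is linear in its first argument;
   no topology is put on R[i] itself, so limits of scalars are taken in the
   regular normed module R[i]^o. *)
HB.mixin Record NormedModule_isHilbert (R : realType) H
    of CompleteNormedModule R[i] H := {
  inner : {dot H for conjC} ;
  inner_norm : forall x : H, `|x| ^+ 2 = inner x x }.

#[short(type="hilbertType")]
HB.structure Definition Hilbert (R : realType) :=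
  { H of NormedModule_isHilbert R H & CompleteNormedModule R[i] H }.

Definition separable_space (T : topologicalType) :=
  exists2 A : set T, countable A & dense A.

Section Operators.
Variables (R : realType) (H : hilbertType R).
Implicit Types (T : H -> H) (x y : nat -> H).

Definition bounded_operator T :=
  linear T /\ exists M : R[i], forall u : H, `|T u| <= M * `|u|.

(* The order of R[i] makes 0 <= z include that z is real. *)
Definition positive_operator T :=
  bounded_operator T /\ forall u : H, 0 <= inner (T u) u.

Definition square_summable x := cvgn (series (fun k => `|x k| ^+ 2 : R[i]^o)).

Definition ultraweak_functional x y T : R[i]^o :=
  limn (series (fun k => inner (T (x k)) (y k) : R[i]^o)).

(* The ultraweak topology on B(H) is the initial topology for the functionals
   T |-> \sum_k <T x_k, y_k>, for x and y square-summable sequences in H. *)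
Definition ultraweak_cvg (Tn : nat -> H -> H) T :=
  forall x y, square_summable x -> square_summable y ->
    ultraweak_functional x y (Tn n) @[n --> \oo] --> ultraweak_functional x y T.

End Operators.

Definition borel {X : topologicalType} : set (set X) := <<s @open X >>.

Section POVM.
Variables (R : realType) (X : topologicalType).

(* A POVM is a function on all subsets of X of which only the values on Borel
   sets matter, as for the measures of the library. Finite disjoint families
   are sequences that are eventually set0: the constant sequence set0 already
   forces nu set0 = 0. Operators are added pointwise. *)
Definition is_povm (H : hilbertType R) (nu : set X -> H -> H) :=
  (forall E, borel E -> positive_operator (nu E)) /\
  (forall E : nat -> set X, (forall k, borel (E k)) -> trivIset setT E ->
    ultraweak_cvg (fun n => \sum_(k < n) nu (E k)) (nu (\bigcup_k E k))).

Definition povm_ac (H2 H1 : hilbertType R)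
    (theta2 : set X -> H2 -> H2) (theta1 : set X -> H1 -> H1) :=
  forall E, borel E -> theta1 E = 0 -> theta2 E = 0.

Definition povm_singular (H1 H2 : hilbertType R)
    (theta1 : set X -> H1 -> H1) (theta2 : set X -> H2 -> H2) :=
  exists A B : set X,
    [/\ borel A, borel B, A `&` B = set0, A `|` B = setT &
      (forall E, borel E -> E `<=` B -> theta1 E = 0) /\
      (forall E, borel E -> E `<=` A -> theta2 E = 0)].

Definition lebesgue_decomposition (H1 H2 : hilbertType R)
    (nu : set X -> H1 -> H1) (omega omega_a omega_s : set X -> H2 -> H2) :=
  [/\ is_povm omega_a, is_povm omega_s,
      forall E, borel E -> omega E = omega_a E + omega_s E,
      povm_ac omega_a nu & povm_singular omega_s nu].

End POVM.

(* Main.v *)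
Require Import Defs.
From mathcomp Require Import all_boot all_order all_algebra.
From mathcomp Require Import sesquilinear complex ring lra.
From mathcomp Require Import all_classical all_reals all_analysis.

(** The whole theorem comes down to one Borel set: a nu-null set N that carries
    as much of omega as a nu-null set can, in the sense that
    omega (E \ N) = 0 for every nu-null E (maximal_null). Given N, the parts
    are the restrictions of omega to N (singular) and to its complement
    (absolutely continuous).

    Such an N is found by exhaustion (maximal_null_exists). For one vector u,
    the number <omega E u, u> is monotone in E and bounded by
    <omega X u, u>, so it has a supremum over the nu-null E; a countable union
    of nu-null sets approaching this supremum is nu-null and attains it, and by
    additivity no nu-null set outside the union has positive mass for u. The
    union of these sets over a countable dense set of vectors u works for all
    of them at once, and a positive operator whose quadratic form vanishes on a
    dense set is 0 (positive_eq0_dense).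

    For uniqueness, the set on which a given singular part is concentrated is
    itself a maximal null set, and that singular part is the restriction of
    omega to it (decomposition_maximal_null); two maximal null sets differ by
    omega-null sets only (maximal_null_setI).

    Ultraweak convergence enters only through its consequence
    <Tn u, v> --> <T u, v>, obtained by testing against sequences concentrated
    at index 0. It yields finite additivity and the fact that a countable union
    of null sets is null. *)

Set Implicit Arguments.
Unset Strict Implicit.
Unset Printing Implicit Defensive.

Import Order.TTheory GRing.Theory Num.Theory Num.Def.
Import numFieldNormedType.Exports.

Local Open Scope classical_set_scope.
Local Open Scope complex_scope.
Local Open Scope ring_scope.

(** * Positive operators and their quadratic forms *)

Section Operators.
Variables (R : realType) (H : hilbertType R).
Implicit Types (S T : H -> H) (u v w : H).

Lemma innerC u v : inner u v = (inner v u)^*.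
Proof. by rewrite hermC expr0 mul1r. Qed.

Lemma inner_self_eq0 u : inner u u = 0 -> u = 0.
Proof. by move=> /eqP; rewrite -inner_norm sqrf_eq0 normr_eq0 => /eqP. Qed.

Lemma bounded_operatorD T u v : bounded_operator T -> T (u + v) = T u + T v.
Proof. by move=> [linT _]; have := linT 1 u v; rewrite !scale1r. Qed.

Lemma bounded_operator0 T : bounded_operator T -> T 0 = 0.
Proof.
move=> bT; have := bounded_operatorD 0 0 bT.
by rewrite addr0 => /eqP; rewrite -subr_eq subrr eq_sym => /eqP.
Qed.

Lemma bounded_operatorZ T a u : bounded_operator T -> T (a *: u) = a *: T u.
Proof.
by move=> bT; have := bT.1 a u 0; rewrite (bounded_operator0 bT) !addr0.
Qed.

Lemma bounded_operatorN T u : bounded_operator T -> T (- u) = - T u.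
Proof. by move=> bT; rewrite -scaleN1r bounded_operatorZ// scaleN1r. Qed.

(** Polarization: expanding the form at u + v and at u + 'i v, with v = T u,
    gives both <v, v> + <T v, u> = 0 and <T v, u> = <v, v>. The second identity
    is where complex scalars are used. *)
Lemma operator_eq0_quadratic T : bounded_operator T ->
  (forall u, inner (T u) u = 0) -> T = 0.
Proof.
move=> bT T0; apply/funext => u; apply: inner_self_eq0.
set v := T u.
have := T0 (u + v); rewrite bounded_operatorD// linearDl/= !linearDr/= !T0.
rewrite add0r addr0 => e1.
have := T0 (u + 'i *: v).
rewrite bounded_operatorD// bounded_operatorZ// linearDl/= !linearDr/= T0.
rewrite linearZl_LR !linearZr_LR linearZl_LR/= T0 !mulr0 add0r addr0.
rewrite conjCi.
rewrite mulNr addrC -mulrBr => /eqP; rewrite mulf_eq0 (negPf (neq0Ci _))/=.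
rewrite subr_eq0 => /eqP e2.
by move: e1; rewrite addrC e2 => /eqP; rewrite -mulr2n mulrn_eq0/= => /eqP.
Qed.

(** Since <T u, u> is real, expanding 0 <= |T u - u|^2 bounds 2 <T u, u> by
    |T u|^2 + |u|^2; this stands in for the Cauchy-Schwarz inequality. *)
Lemma positive_quadratic_le T : positive_operator T ->
  exists2 M : R[i], 0 <= M & forall u, inner (T u) u <= M * `|u| ^+ 2.
Proof.
move=> [bT T0]; have [K TK] := bT.2; exists (`|K| ^+ 2 + 1).
  by rewrite addr_ge0 ?exprn_ge0.
move=> u.
have qC : inner u (T u) = inner (T u) u.
  by rewrite innerC; apply/CrealP; rewrite realE T0.
have := dnorm_ge0 (inner (s := H)) (T u - u).
rewrite linearBl/= !linearBr/= -!inner_norm qC => sq_ge0.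
have sq_le : `|T u| ^+ 2 <= `|K| ^+ 2 * `|u| ^+ 2.
  rewrite -exprMn ler_pXn2r ?nnegrE ?mulr_ge0//.
  rewrite -(normr_id u) -normrM ger0_norm//.
  exact: le_trans (normr_ge0 _) (TK u).
(* Here q = <T u, u> >= 0 absorbs one of the two copies of q. *)
have key (a b q : R[i]) : 0 <= a - q - (q - b) -> 0 <= q -> q <= a + b.
  move=> h q0; rewrite -subr_ge0.
  have -> : a + b - q = a - q - (q - b) + q.
    by ring.
  exact: addr_ge0.
rewrite mulrDl mul1r; apply: (le_trans (key _ _ _ sq_ge0 (T0 u))).
by rewrite lerD2r.
Qed.

Lemma quadratic_parallelogram T u v : bounded_operator T ->
  inner (T (u + v)) (u + v) + inner (T (u - v)) (u - v) =
  (inner (T u) u + inner (T v) v) *+ 2.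
Proof.
move=> bT; rewrite !(bounded_operatorD _ _ bT) (bounded_operatorN _ bT).
have cancel4 (a b c d : R[i]) :
  a + b + (c + d) + (a - b - (c - d)) = (a + d) *+ 2 by ring.
rewrite !linearDl/= !linearNl !linearDr/= !linearNr; exact: cancel4.
Qed.

Lemma positive_quadratic_leD T u v : positive_operator T ->
  inner (T (u + v)) (u + v) <= (inner (T u) u + inner (T v) v) *+ 2.
Proof. by move=> [bT T0]; rewrite -quadratic_parallelogram// lerDl. Qed.

(** If v is a point of D near u, then <T u, u> <= 2 <T (u - v), u - v>, which is
    O(|u - v|^2), because <T v, v> = 0. *)
Lemma positive_eq0_dense T (D : set H) : dense D -> positive_operator T ->
  (forall v, D v -> inner (T v) v = 0) -> T = 0.
Proof.
move=> dD pT TD0; apply: operator_eq0_quadratic pT.1 _ => u.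
have [M M0 TM] := positive_quadratic_le pT.
apply/eqP; apply: contraT => q0; set q := inner (T u) u.
have {}q0 : 0 < q by rewrite lt_def q0 pT.2.
have d0 : 0 < 2 * M + q by rewrite ltr_wpDl// mulr_ge0.
(* This radius satisfies both e <= 1, so that M e ^ 2 <= M e, and 2 M e < q. *)
pose e := q / (2 * M + q).
have e0 : 0 < e by rewrite divr_gt0.
have e1 : e <= 1.
  by rewrite ler_pdivrMr// mul1r lerDr mulr_ge0.
have [v [uv Dv]] : (ball u e)° `&` D !=set0.
  apply: dD (open_interior _); exists u.
  exact: nbhsx_ballx.
move: (interior_subset uv); rewrite -ball_normE/= => {}uv.
have : q <= M * e *+ 2.
  have := positive_quadratic_leD (u - v) v pT.
  rewrite subrK (TD0 _ Dv) addr0 => /le_trans; apply.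
  rewrite lerMn2r/=; apply: le_trans (TM _) _.
  apply: ler_wpM2l => //; apply: le_trans (ltW uv).
  rewrite expr2 ler_piMl//; exact: le_trans (ltW uv) e1.
have : M * e *+ 2 < q.
  rewrite /e [X in X < _](_ : _ = (q * (2 * M)) / (2 * M + q)); last by ring.
  by rewrite ltr_pdivrMr// ltr_pM2l// ltrDl.
by move=> /le_lt_trans /[apply]; rewrite ltxx.
Qed.

(** * Consequences of ultraweak convergence *)

Definition head_seq (u : H) (k : nat) : H := if k == 0%N then u else 0.

Lemma cvg_series_head (f : nat -> R[i]^o) : (forall k, f k.+1 = 0) ->
  series f n @[n --> \oo] --> f 0%N.
Proof.
move=> f0; apply: cvg_near_cst; near=> n.
have : (0 < n)%N by near: n; exact: nbhs_infty_gt.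
move: (n) => [//|m] _.
by rewrite seriesEnat/= big_nat_recl//= big1 ?addr0.
Unshelve. all: by end_near. Qed.

Lemma square_summable_head u : square_summable (head_seq u).
Proof.
apply/cvg_ex; exists (`|head_seq u 0%N| ^+ 2 : R[i]^o).
by apply: (cvg_series_head (f := fun k => `|head_seq u k| ^+ 2)) => k;
  rewrite normr0 expr0n.
Qed.

Lemma ultraweak_functional_head u v T :
  ultraweak_functional (head_seq u) (head_seq v) T = inner (T u) v.
Proof.
apply: cvg_lim => //.
apply: (cvg_series_head
  (f := fun k => inner (T (head_seq u k)) (head_seq v k))) => k.
by rewrite linear0r.
Qed.

Lemma ultraweak_cvg_inner (Tn : nat -> H -> H) T u v : ultraweak_cvg Tn T ->
  inner (Tn n u) v @[n --> \oo] --> (inner (T u) v : R[i]^o).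
Proof.
move=> /(_ _ _ (@square_summable_head u) (@square_summable_head v)).
rewrite ultraweak_functional_head.
by under eq_fun do rewrite ultraweak_functional_head.
Qed.

Arguments ultraweak_cvg_inner {Tn T} u v _.

Lemma operator_eq_inner S T :
  (forall u v, inner (S u) v = inner (T u) v) -> S = T.
Proof.
move=> ST; apply/funext => u; apply/eqP; rewrite -subr_eq0.
by apply/eqP/inner_self_eq0; rewrite linearBl/= ST subrr.
Qed.

Lemma ultraweak_cvg_near_cst (Tn : nat -> H -> H) S T :
  (\forall n \near \oo, Tn n = S) -> ultraweak_cvg Tn T -> T = S.
Proof.
move=> TnS TnT; apply: operator_eq_inner => u v.
have cS : inner (Tn n u) v @[n --> \oo] --> (inner (S u) v : R[i]^o).
  by apply: cvg_near_cst; apply: filterS TnS => n ->.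
have cT := ultraweak_cvg_inner u v TnT.
exact: (cvg_unique (@norm_hausdorff _ R[i]^o) cT cS).
Qed.

(** The limit c of c *+ n is also the limit of c *+ n.+1 = c *+ n + c, hence
    c = c + c. *)
Lemma ultraweak_cvg_mulrn S : ultraweak_cvg (fun n => S *+ n) S -> S = 0.
Proof.
move=> SS; apply: operator_eq_inner => u v; rewrite linear0l.
pose c : R[i]^o := inner (S u) v.
have cc : (c *+ n) @[n --> \oo] --> c.
  have innerMn n : inner ((S *+ n) u) v = c *+ n.
    by elim: n => [|n IH]; rewrite ?mulr0n ?linear0l// !mulrSr linearDl/= IH.
  have := ultraweak_cvg_inner u v SS.
  by under eq_fun do rewrite innerMn.
have : (c *+ n + c) @[n --> \oo] --> c + c by apply: cvgD => //; exact: cvg_cst.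
under eq_fun do rewrite -mulrSr.
rewrite (cvg_shiftS (fun n => c *+ n)) => cc2.
have cE : c = c + c by exact: (cvg_unique (@norm_hausdorff _ R[i]^o) cc cc2).
apply: (addrI c); rewrite addr0; exact: esym cE.
Qed.

End Operators.

(** * Borel sets *)

Section Borel.
Context {X : topologicalType}.
Implicit Types A B : set X.

Lemma borel0 : borel (set0 : set X).
Proof. exact: sigma_algebra0. Qed.

Lemma borelC A : borel A -> borel (~` A).
Proof. rewrite -setTD; exact: sigma_algebraCD. Qed.

Lemma borelT : borel (setT : set X).
Proof. by rewrite -setC0; apply: borelC; exact: borel0. Qed.

Lemma borel_bigcup (F : nat -> set X) :
  (forall k, borel (F k)) -> borel (\bigcup_k F k).
Proof. exact: sigma_algebra_bigcup. Qed.

Lemma borelU A B : borel A -> borel B -> borel (A `|` B).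
Proof.
by move=> bA bB; rewrite -bigcup2E; apply: borel_bigcup => -[|[|k]]//=;
  exact: borel0.
Qed.

Lemma borelI A B : borel A -> borel B -> borel (A `&` B).
Proof.
move=> bA bB; rewrite -(setCK (A `&` B)) setCI.
by apply: borelC; apply: borelU; exact: borelC.
Qed.

Lemma borelD A B : borel A -> borel B -> borel (A `\` B).
Proof. by move=> bA bB; rewrite setDE; apply: borelI => //; exact: borelC. Qed.

Lemma borel_seqDU (F : nat -> set X) n :
  (forall k, borel (F k)) -> borel (seqDU F n).
Proof.
move=> bF; apply: borelD => //.
elim/big_ind: _ => [|C D|k _]; [exact: borel0|exact: borelU|exact: bF].
Qed.

End Borel.

(** * Additivity, monotonicity and null sets of a POVM *)

Section Povm.
Context {R : realType} {X : topologicalType} {H : hilbertType R}.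
Variable nu : set X -> H -> H.
Hypothesis nu_povm : is_povm nu.
Implicit Types A B E : set X.

Lemma povm_bounded E : borel E -> bounded_operator (nu E).
Proof. by move=> /(nu_povm.1 _) []. Qed.

Lemma povm_ge0 E u : borel E -> 0 <= inner (nu E u) u.
Proof. by move=> /(nu_povm.1 _) []. Qed.

(** Countable additivity for the constant sequence set0, whose n-th partial sum
    is nu set0 *+ n. *)
Lemma povm0 : nu set0 = 0.
Proof.
have disj0 : trivIset setT (fun _ : nat => set0 : set X).
  by move=> i j _ _ [x []].
have := nu_povm.2 _ (fun=> borel0) disj0.
rewrite bigcup0//; set T := nu set0 => sumT; apply: ultraweak_cvg_mulrn.
suff -> : (fun n => T *+ n) = (fun n => \sum_(k < n) T) by [].
by apply/funext => n; rewrite sumr_const card_ord.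
Qed.

Lemma povmU A B : borel A -> borel B -> A `&` B = set0 ->
  nu (A `|` B) = nu A + nu B.
Proof.
move=> bA bB; rewrite trivIset_bigcup2 => AB.
have bAB k : borel (bigcup2 A B k) by case: k => [|[|k]]//=; exact: borel0.
have := nu_povm.2 _ bAB AB; rewrite bigcup2E; apply: ultraweak_cvg_near_cst.
near=> n; have : (1 < n)%N by near: n; exact: nbhs_infty_gt.
move: (n) => [|[|m]]// _.
by rewrite 2!big_ord_recl/= big1 ?addr0// => i _; rewrite povm0.
Unshelve. all: by end_near. Qed.

Lemma povmID A E : borel A -> borel E -> nu E = nu (E `&` A) + nu (E `\` A).
Proof.
move=> bA bE; rewrite -povmU ?setUIDK//; [exact: borelI|exact: borelD|].
by rewrite setDE setIACA setICr setI0.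
Qed.

Lemma le_povm A B u : borel A -> borel B -> A `<=` B ->
  inner (nu A u) u <= inner (nu B u) u.
Proof.
move=> bA bB /setIidr AB; rewrite (povmID bA bB) AB linearDl/= lerDl.
by apply: povm_ge0; exact: borelD.
Qed.

Lemma povm_sub_eq0 A B : borel A -> borel B -> A `<=` B -> nu B = 0 -> nu A = 0.
Proof.
move=> bA bB AB nuB; apply: operator_eq0_quadratic (povm_bounded bA) _ => u.
apply/eqP; rewrite eq_le povm_ge0// andbT.
by have := le_povm u bA bB AB; rewrite nuB linear0l.
Qed.

(** After the sets are made disjoint, all partial sums vanish, hence so does
    their limit. *)
Lemma povm_bigcup_eq0 (F : nat -> set X) : (forall k, borel (F k)) ->
  (forall k, nu (F k) = 0) -> nu (\bigcup_k F k) = 0.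
Proof.
move=> bF nuF; rewrite seqDU_bigcup_eq.
have nuD k : nu (seqDU F k) = 0.
  exact: povm_sub_eq0 (borel_seqDU k bF) (bF k) (@subset_seqDU _ _ _) (nuF k).
have := nu_povm.2 _ (fun k => borel_seqDU k bF) (trivIset_seqDU F).
by apply: ultraweak_cvg_near_cst; apply: nearW => n; rewrite big1.
Qed.

Lemma povm_setI A : borel A -> is_povm (fun E => nu (E `&` A)).
Proof.
move=> bA; split=> [E bE|E bE tE]; first by apply: nu_povm.1; exact: borelI.
rewrite setI_bigcupl; apply: nu_povm.2; first by move=> k; exact: borelI.
exact: trivIset_setIr.
Qed.

End Povm.

(** * Maximal null sets and the decomposition *)

Section MaximalNull.
Context {R : realType} {X : topologicalType} {H1 H2 : hilbertType R}.
Variables (nu : set X -> H1 -> H1) (omega : set X -> H2 -> H2).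
Hypotheses (nu_povm : is_povm nu) (omega_povm : is_povm omega).
Implicit Types E N : set X.

(** Maximality up to omega-null sets: a nu-null set cannot carry any part of
    omega outside N. *)
Definition maximal_null N := [/\ borel N, nu N = 0 &
  forall E, borel E -> nu E = 0 -> omega (E `\` N) = 0].

(** Exhaustion for the finite scalar measure E |-> <omega E u, u>: N is the
    union of nu-null sets whose masses approach the supremum, so the mass of
    E \ N cannot be positive without N `|` E exceeding that supremum. *)
Lemma maximal_null_quadratic (u : H2) : exists N, [/\ borel N, nu N = 0 &
  forall E, borel E -> nu E = 0 -> inner (omega (E `\` N) u) u = 0].
Proof.
pose q E : R := complex.Re (inner (omega E u) u).
have q_le A B : borel A -> borel B -> A `<=` B -> q A <= q B.
  by move=> bA bB /(le_povm omega_povm u bA bB); rewrite lecE => /andP[].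
pose S := [set q E | E in [set E | borel E /\ nu E = 0]].
have supS : has_sup S.
  split.
    by exists (q set0), set0 => //; split; [exact: borel0|exact: povm0].
  exists (q setT) => _ [E [bE _] <-]; apply: q_le => //; exact: borelT.
have /choice[F FP] n : exists E,
    [/\ borel E, nu E = 0 & sup S - n.+1%:R^-1 < q E].
  have e0 : 0 < n.+1%:R^-1 :> R by rewrite invr_gt0 ltr0n.
  by have [_ [E [bE nuE] <-] qE] := sup_adherent e0 supS; exists E.
have bF k : borel (F k) by have [] := FP k.
have nuF k : nu (F k) = 0 by have [] := FP k.
set N := \bigcup_k F k.
have bN : borel N by exact: borel_bigcup.
have nuN : nu N = 0 by exact: povm_bigcup_eq0.
exists N; split=> // E bE nuE.
have bEN : borel (E `\` N) by exact: borelD.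
have disj : N `&` (E `\` N) = set0 by rewrite setDE setICA setICr setI0.
have nuEN : nu (N `|` E `\` N) = 0.
  rewrite povmU// nuN add0r.
  by apply: povm_sub_eq0 bEN bE _ nuE => // x [].
have qD : q N + q (E `\` N) <= sup S.
  have -> : q N + q (E `\` N) = q (N `|` E `\` N).
    by rewrite /q povmU// linearDl/= raddfD.
  apply: ub_le_sup supS.2 _ _; exists (N `|` E `\` N) => //.
  by split => //; exact: borelU.
have q_le0 : q (E `\` N) <= 0.
  rewrite leNgt; apply/negP => /ltr_add_invr[n]; rewrite add0r => n_lt.
  have [_ _ Fn] := FP n.
  have FN : q (F n) <= q N by apply: q_le => //; exact: bigcup_sup.
  move: qD Fn FN n_lt.
  move: (q (E `\` N)) (q N) (q (F n)) (sup S) (n.+1%:R^-1) => a b c d e.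
  by lra.
have := povm_ge0 omega_povm u bEN; rewrite lecE/= => /andP[/eqP im0 re0].
by apply/eqP; rewrite eq_complex/= im0 eqxx andbT eq_le q_le0.
Qed.

(** For v in the dense set, E \ N lies in the complement in E of the set that
    is maximal for v, so monotonicity gives <omega (E \ N) v, v> = 0. *)
Lemma maximal_null_exists : separable_space H2 -> exists N, maximal_null N.
Proof.
move=> [D cD dD].
have [v0 [_ Dv0]] : setT `&` D !=set0.
  by apply: dD; [exists 0|exact: openT].
have /choice[M MP] := maximal_null_quadratic.
have [|[f]] := pfcard_geP cD.
  by move=> D0; rewrite D0 in Dv0.
have bM u : borel (M u) by have [] := MP u.
pose N := \bigcup_k M (f k).
have bN : borel N by exact: borel_bigcup.
exists N; split => //.
  by apply: povm_bigcup_eq0 => // k; have [] := MP (f k).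
move=> E bE nuE; have bEN : borel (E `\` N) by exact: borelD.
apply: (positive_eq0_dense dD); first exact: omega_povm.1.
move=> v Dv; have [_ _ /(_ E bE nuE) qv] := MP v.
apply/eqP; rewrite eq_le povm_ge0// andbT -qv.
apply: le_povm => //; first exact: borelD.
apply: setDS; have [k _ <-] := @surj _ _ _ _ f v Dv; exact: bigcup_sup.
Qed.

Lemma maximal_null_decomposition N : maximal_null N ->
  lebesgue_decomposition nu omega
    (fun E => omega (E `&` ~` N)) (fun E => omega (E `&` N)).
Proof.
move=> [bN nuN maxN]; split.
- by apply: povm_setI => //; exact: borelC.
- exact: povm_setI.
- by move=> E bE; rewrite (povmID omega_povm bN bE) addrC.
- by move=> E bE nuE; rewrite -setDE maxN.
- exists N, (~` N); split; rewrite ?setICr ?setUCr//; first exact: borelC.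
  split=> E bE EN; last exact: povm_sub_eq0 EN nuN.
  have -> : E `&` N = set0 by apply/disjoints_subset.
  exact: povm0.
Qed.

(** Let N be the nu-null side of the splitting X = N + B witnessing
    singularity. On B the singular part vanishes, so there omega is absolutely
    continuous and N is maximal; on N the absolutely continuous part vanishes,
    so there omega is the singular part. *)
Lemma decomposition_maximal_null omega_a omega_s :
  lebesgue_decomposition nu omega omega_a omega_s ->
  exists2 N, maximal_null N & forall E, borel E -> omega_s E = omega (E `&` N).
Proof.
move=> [povm_a povm_s omegaE ac_a [N [B [bN bB NB0 NBT [s0 nu0]]]]].
have nuN : nu N = 0 by exact: nu0.
have a0 E : borel E -> nu E = 0 -> omega_a E = 0 by exact: ac_a.
have DNB E : E `\` N `<=` B.
  move=> x [_ Nx]; have : [set: X] x by [].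
  by rewrite -NBT => -[].
exists N => [|E bE].
  split=> // E bE nuE; have bEN := borelD bE bN.
  rewrite omegaE// (s0 _ bEN (@DNB E)) a0 ?addr0//.
  exact: povm_sub_eq0 (@subDsetl _ _ _) nuE.
have bEN := borelI bE bN.
rewrite omegaE// a0 ?add0r//; last first.
  exact: povm_sub_eq0 (@subIsetr _ _ _) nuN.
by rewrite (povmID povm_s bN bE) (s0 _ (borelD bE bN) (@DNB E)) addr0.
Qed.

(** As N is nu-null and N' maximal, omega vanishes on E `&` N `\` N'; both
    sides thus equal omega on E `&` N `&` N'. *)
Lemma maximal_null_setI N N' E : maximal_null N -> maximal_null N' -> borel E ->
  omega (E `&` N) = omega (E `&` N').
Proof.
have half M M' : maximal_null M -> maximal_null M' -> borel E ->
    omega (E `&` M) = omega (E `&` M `&` M').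
  move=> [bM nuM _] [bM' _ maxM'] bE; have bEM := borelI bE bM.
  rewrite (povmID omega_povm bM' bEM) maxM' ?addr0//.
  exact: povm_sub_eq0 (@subIsetr _ _ _) nuM.
by move=> mN mN' bE; rewrite (half N N')// (half N' N)// setIAC.
Qed.

End MaximalNull.

Theorem theorem3p8 (R : realType) (X : topologicalType) (H1 H2 : hilbertType R)
    (X_hausdorff : hausdorff_space X)
    (X_locally_compact : locally_compact (@setT X))
    (H1_separable : separable_space H1) (H2_separable : separable_space H2)
    (nu : set X -> H1 -> H1) (omega : set X -> H2 -> H2)
    (nu_povm : is_povm nu) (omega_povm : is_povm omega) :
  exists omega_a omega_s : set X -> H2 -> H2,
    lebesgue_decomposition nu omega omega_a omega_s /\
    (forall omega_a' omega_s' : set X -> H2 -> H2,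
      lebesgue_decomposition nu omega omega_a' omega_s' ->
      forall E : set X, borel E ->
        omega_a' E = omega_a E /\ omega_s' E = omega_s E).
Proof.
have [N maxN] := maximal_null_exists nu_povm omega_povm H2_separable.
have dec := maximal_null_decomposition nu_povm omega_povm maxN.
exists (fun E => omega (E `&` ~` N)), (fun E => omega (E `&` N)).
split=> // a' s' dec' E bE.
have [N' maxN' sE] := decomposition_maximal_null nu_povm dec'.
have s'E : s' E = omega (E `&` N).
  by rewrite sE//; apply: (maximal_null_setI nu_povm omega_povm maxN' maxN).
split=> //; have [_ _ sum' _ _] := dec'; have [_ _ sum _ _] := dec.
by apply: (addIr (s' E)); rewrite -sum'// s'E -sum.
Qed.
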